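(* Let $f:2^X\to\mathbb{R}_{\ge0}$ be a monotone nondecreasing function (not necessarily submodular) with curvature at most $c\in[0,1]$, and let $\mathcal{M}=(X,\mathcal{I})$ be a matroid. Let $S$ be the base produced by the standard greedy maximization algorithm on $f$ and $\mathcal{M}$, and let $O$ be any base of $\mathcal{M}$. Then $f(S)\ge(1-c)f(O)$.
   Context: $f_A(j)=f(A\cup\{j\})-f(A)$. For a monotone function, the (generalized) curvature is $c=1-\min_{j\in X}\min_{S,T\subseteq X\setminus\{j\}}\frac{f_S(j)}{f_T(j)}$; for nondecreasing $f$, having curvature at most $c$ means $(1-c)f_B(j)\le f_A(j)$ for all $j\in X$ and $A,B\subseteq X\setminus\{j\}$. The standard greedy maximization algorithm starts from $S=\emptyset$ and repeatedly adds to $S$ an element $e\notin S$ with $S\cup\{e\}\in\mathcal{I}$ maximizing $f_S(e)$, until no such element exists. *)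

(* Defs.v *)
From mathcomp Require Import all_boot all_order all_algebra.
From mathcomp Require Import reals.

Set Implicit Arguments.
Unset Strict Implicit.
Unset Printing Implicit Defensive.

Import Order.TTheory GRing.Theory Num.Theory.
Local Open Scope ring_scope.

(* The ground set is the whole finite type X. *)
Record matroid (X : finType) := Matroid {
  indep : {set {set X}};
  indep0 : set0 \in indep;
  indep_sub : forall A B : {set X}, A \subset B -> B \in indep -> A \in indep;
  indep_aug : forall A B : {set X}, A \in indep -> B \in indep ->
    (#|A| < #|B|)%N -> exists2 x, x \in B :\: A & x |: A \in indep }.

Definition is_base (X : finType) (M : matroid X) (B : {set X}) : bool :=
  maxset [in indep M] B.

Section SetFunction.
Variables (R : realType) (X : finType).
Implicit Types (f : {set X} -> R) (S A B : {set X}) (M : matroid X).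

Definition marginal f A (j : X) : R := f (j |: A) - f A.

Definition nondecreasing_set_fun f : Prop :=
  forall A B, A \subset B -> f A <= f B.

(* The division-free form of
     c >= 1 - min_j min_(S, T \subset X \ {j}) (f_S(j) / f_T(j)),
   which also makes sense when some marginal f_T(j) vanishes. *)
Definition curvature_at_most f (c : R) : Prop :=
  forall (j : X) A B, A \subset [set~ j] -> B \subset [set~ j] ->
    (1 - c) * marginal f B j <= marginal f A j.

Definition addable M S (e : X) : bool := (e \notin S) && (e |: S \in indep M).

(* Ties between maximizers are broken arbitrarily, so the algorithm is a
   relation: greedy_state f M S says that S occurs as the current set in some
   run, and greedy_output f M S that some run stops with S. *)
Inductive greedy_state f M : {set X} -> Prop :=
| greedy_start : greedy_state f M set0
| greedy_step S e :
    greedy_state f M S ->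
    addable M S e ->
    (forall e', addable M S e' -> marginal f S e' <= marginal f S e) ->
    greedy_state f M (e |: S).

Definition greedy_output f M S : Prop :=
  greedy_state f M S /\ (forall e, ~~ addable M S e).

End SetFunction.

(* Main.v *)
(** If [S'] is the greedy set one step before [S] and [O] is an independent set
    with [#|S'| < #|O|], the augmentation axiom gives [x] in [O :\: S'] that the
    greedy algorithm could have added to [S'].  Greedy's choice gains at least
    the marginal of [x] at [S'], which by the curvature bound is at least
    [1 - c] times the marginal of [x] at [O :\ x]; induct on [O :\ x] and [S']. *)
Require Import Defs.
From mathcomp Require Import all_boot all_order all_algebra.
From mathcomp Require Import reals.
From mathcomp Require Import lra.
Import Order.TTheory GRing.Theory Num.Theory.
Local Open Scope ring_scope.

Lemma greedy_state_indep {R : realType} {X : finType} {f : {set X} -> R}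
    {M : matroid X} {S : {set X}} :
  greedy_state f M S -> S \in indep M.
Proof. by case=> [|T e _ /andP[]]; first exact: indep0. Qed.

Lemma addable_aug {X : finType} {M : matroid X} {A B : {set X}} :
  A \in indep M -> B \in indep M -> (#|A| < #|B|)%N ->
  exists2 x, x \in B & addable M A x.
Proof.
move=> iA iB /(indep_aug iA iB)[x /setDP[xB xA] ixA].
by exists x => //; apply/andP.
Qed.

(** Undoing a greedy step and deleting from [O] need not leave bases; independence and
    [#|O| <= #|S|] are what the induction can carry. *)
Lemma greedy_state_ge (R : realType) (X : finType) (f : {set X} -> R) (c : R)
    (M : matroid X) (S O : {set X}) :
  (forall A : {set X}, 0 <= f A) -> nondecreasing_set_fun f -> 0 <= c ->
  curvature_at_most f c -> greedy_state f M S ->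
  O \in indep M -> (#|O| <= #|S|)%N -> (1 - c) * f O <= f S.
Proof.
move=> f_ge0 f_mono c_ge0 f_curv gS.
elim: gS O => [|{}S e gS IH /andP[eS _] e_max] O iO.
  rewrite cards0 leqn0 cards_eq0 => /eqP->.
  by rewrite ler_piMl // gerBl.
rewrite cardsU1 eS add1n => leOS.
(* If [O] is no larger than the earlier set, monotonicity suffices; augmentation needs
   [#|S| < #|O|]. *)
have [leO|ltO] := leqP #|O| #|S|.
  exact: le_trans (IH _ iO leO) (f_mono _ _ (subsetUr _ _)).
have [x xO x_add] := addable_aug (greedy_state_indep gS) iO ltO.
have leOx : (#|O :\ x| <= #|S|)%N by rewrite (cardsD1 x) xO in leOS.
have IHx := IH _ (indep_sub (subD1set O x) iO) leOx.
have sSx : S \subset [set~ x] by rewrite subsetC sub1set inE; case/andP: x_add.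
have sOx : O :\ x \subset [set~ x] by rewrite setDE subsetIr.
have := f_curv x S (O :\ x) sSx sOx; have := e_max x x_add.
by rewrite /marginal setD1K // mulrBr; lra.
Qed.

Theorem theorem11 (R : realType) (X : finType) (f : {set X} -> R) (c : R)
    (M : matroid X) (S O : {set X})
    (f_ge0 : forall A : {set X}, 0 <= f A)
    (f_mono : nondecreasing_set_fun f)
    (c_ge0 : 0 <= c) (c_le1 : c <= 1)
    (f_curv : curvature_at_most f c)
    (S_greedy : greedy_output f M S)
    (O_base : is_base M O) :
  (1 - c) * f O <= f S.
Proof.
have [gS S_stop] := S_greedy.
have iO : O \in indep M by have /maxsetp := O_base.
(* Were [O] larger than [S], augmentation would yield an element still addable, so the run could not
   have stopped. *)
apply: (greedy_state_ge _ _ f c M) => //; rewrite leqNgt; apply/negP => ltSO.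
have [x _ x_add] := addable_aug (greedy_state_indep gS) iO ltSO.
by have := S_stop x; rewrite x_add.
Qed.
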